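(* Let $p$ be a prime, let $G$ be a finite abelian $p$-group, let $\sigma$ be a skew-morphism of $G$, and suppose that $X=G\langle\sigma\rangle$ is a skew-product $p$-group, i.e. $|\sigma|=p^m$ for some $m\ge 1$. Let $N=\operatorname{Core}_X(G)$. Then: (1) $Z(X)\le N$; in particular, $N\neq 1$ whenever $X\ne 1$; (2) if $X$ has nilpotency class at most $2$, then $G\trianglelefteq X$ and $\sigma$ is a group automorphism of $G$; (3) if $G\not\trianglelefteq X$, then $X/N$ is a nonabelian metabelian $p$-group whose center is nontrivial, cyclic, and contained in the image of $\langle\sigma\rangle$ in $X/N$.
   Context: A skew-morphism of a finite group $G$ is a permutation $\sigma$ of $G$ fixing the identity element for which there exists a function $\pi\colon G\to\mathbb{Z}$ with $\sigma(gh)=\sigma(g)\sigma^{\pi(g)}(h)$ for all $g,h\in G$. Its order $|\sigma|$ is its order as a permutation. Let $L_G=\{L_g\mid g\in G\}\le\operatorname{Sym}(G)$, $L_g(h)=gh$, be the left regular representation. The product set $X=L_G\langle\sigma\rangle$ is a subgroup of $\operatorname{Sym}(G)$, called the skew-product group of $G$ by $\sigma$. One identifies $G$ with $L_G$ and writes $X=G\langle\sigma\rangle$. $\operatorname{Core}_X(G)$ denotes the largest normal subgroup of $X$ contained in $G$. A group is metabelian if its commutator subgroup is abelian. *)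

(* Defs.v *)
From HB Require Import structures.
From mathcomp Require Import all_boot all_order all_algebra.
From mathcomp Require Import all_fingroup all_solvable.
Set Implicit Arguments.
Unset Strict Implicit.
Unset Printing Implicit Defensive.

Import GroupScope.

Section SkewMorphisms.

Variable gT : finGroupType.
Implicit Types (g h : gT) (s : {perm gT}).

Definition expgz (hT : finGroupType) (x : hT) (n : int) : hT :=
  match n with
  | Posz k => x ^+ k
  | Negz k => x ^- k.+1
  end.

Definition left_mul g : {perm gT} := perm (@mulgI gT g).

Lemma left_mulE g h : left_mul g h = g * h.
Proof. by rewrite permE. Qed.

Definition left_regular : {set {perm gT}} := [set left_mul g | g in [set: gT]].

Lemma left_regular_group_set : group_set left_regular.
Proof.
apply/group_setP; split.
  by apply/imsetP; exists 1 => //; apply/permP=> x; rewrite left_mulE perm1 mul1g.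
move=> _ _ /imsetP[g _ ->] /imsetP[h _ ->]; apply/imsetP; exists (h * g) => //.
by apply/permP=> x; rewrite permM !left_mulE mulgA.
Qed.

Canonical left_regular_group := Group left_regular_group_set.

Definition skew_morphism s : Prop :=
  s 1 = 1 /\
  exists pi : gT -> int, forall g h, s (g * h) = s g * expgz s (pi g) h.

(* Products in {perm gT} compose from left to right, so this is the set of    *)
(* all the maps h |-> g * (s ^+ i) h, i.e., the product set usually written   *)
(* L_G <s> when permutations are composed as functions.                       *)
Definition skew_product_set s : {set {perm gT}} := <[s]> * left_regular.

Lemma skew_product_group_set s :
  skew_morphism s -> group_set (skew_product_set s).
Proof.
move=> [_ [pi sM]]; apply/comm_group_setP.
have expz_cycle n : expgz s n \in <[s]>.
  by case: n => k /=; rewrite ?groupV mem_cycle.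
have LsS g : left_mul g * s \in <[s]> * left_regular.
  apply/mulsgP; exists (expgz s (pi g)) (left_mul (s g)) => //.
    exact: imset_f.
  by apply/permP=> h; rewrite !permM !left_mulE sM.
have LsiS i g : left_mul g * s ^+ i \in <[s]> * left_regular.
  elim: i g => [|i IHi] g.
    by rewrite mulg1 -[left_mul g]mul1g mem_mulg ?group1 // imset_f.
  rewrite expgS mulgA; case/mulsgP: (LsS g) => c _ cs /imsetP[h _ ->] ->.
  case/mulsgP: (IHi h) => d l ds lL; rewrite -mulgA => ->.
  by rewrite mulgA mem_mulg ?groupM.
have sub : left_regular * <[s]> \subset <[s]> * left_regular.
  apply/subsetP=> _ /mulsgP[_ _ /imsetP[g _ ->] /cycleP[i ->] ->]; exact: LsiS.
apply/eqP; rewrite eq_sym eqEsubset sub /= -invSg !invMg.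
by rewrite !invGid.
Qed.

Definition skew_product s (skew_s : skew_morphism s) : {group {perm gT}} :=
  Group (skew_product_group_set skew_s).

End SkewMorphisms.

Arguments left_regular gT : clear implicits.
Arguments left_regular_group gT : clear implicits.

(* Main.v *)
(* An abelian regular permutation group is its own centralizer, so Z(X) lies in
   G and therefore in N; in class at most 2 this gives X' <= Z(X) <= G, and an
   element normalizing the regular subgroup and fixing 1 is an automorphism.
   In general X / N is the product of the abelian groups G / N and <sigma>N / N,
   hence metabelian by Ito's theorem, and Z(X / N) meets G / N trivially because
   N is the core of G; this forces Z(X / N) into the cyclic factor. *)

Require Import Defs.
From HB Require Import structures.
From mathcomp Require Import all_boot all_order all_algebra.
From mathcomp Require Import all_fingroup all_solvable.
Import GroupScope.

Set Implicit Arguments.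
Unset Strict Implicit.
Unset Printing Implicit Defensive.

Section AbelianFactorizations.

Variable gT : finGroupType.
Implicit Types A B X : {group gT}.

(* Ito's theorem: write b ^ a1 = a2 * b2 and a ^ b1 = b3 * a3; then conjugating
   [~ a, b] by a1 * b1 or by b1 * a1 gives [~ a3, b2] in both cases. *)
Lemma abelian_der1_mul_abelian X A B :
  A * B = X -> abelian A -> abelian B -> abelian X^`(1).
Proof.
move=> defX cAA cBB.
have defX' : B * A = X by rewrite -(invGid X) -defX invMg !invGid.
have sAX : A \subset X by rewrite -defX mulG_subl.
have sBX : B \subset X by rewrite -defX mulG_subr.
have [nRA nRB] : A \subset 'N([~: A, B]) /\ B \subset 'N([~: A, B]).
  by rewrite commg_norml commg_normr.
(* Both factors normalize [[~: A, B]], and modulo it their images are abelian and commute with each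
   other, so the quotient of [X] is abelian. *)
have sX'R : X^`(1) \subset [~: A, B].
  apply: der1_min; rewrite -defX ?mul_subG // quotientMl // abelianM.
  rewrite (quotient_abelian _ cAA) (quotient_abelian _ cBB).
  by rewrite quotient_cents2 //= commGC subxx.
apply: abelianS sX'R _; rewrite /commutator abelian_gen.
have cA x y : x \in A -> y \in A -> [~ x, y] = 1.
  by move=> Ax Ay; apply/eqP/commgP/(centsP cAA).
have cB x y : x \in B -> y \in B -> [~ x, y] = 1.
  by move=> Bx By; apply/eqP/commgP/(centsP cBB).
have conjC a b a1 b1 : a \in A -> b \in B -> a1 \in A -> b1 \in B ->
    [~ a, b] ^ (a1 * b1) = [~ a, b] ^ (b1 * a1).
  move=> Aa Bb Aa1 Bb1.
  have: b ^ a1 \in A * B.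
    by rewrite defX groupJ // ?(subsetP sAX a1) ?(subsetP sBX b).
  case/mulsgP=> a2 b2 Aa2 Bb2 def_ba1.
  have: a ^ b1 \in B * A.
    by rewrite defX' groupJ // ?(subsetP sAX a) ?(subsetP sBX b1).
  case/mulsgP=> b3 a3 Bb3 Aa3 def_ab1.
  have aa1 : a ^ a1 = a by apply/conjg_fixP/eqP/cA.
  have bb1 : b ^ b1 = b by apply/conjg_fixP/eqP/cB.
  have a3a1 : a3 ^ a1 = a3 by apply/conjg_fixP/eqP/cA.
  have b2b1 : b2 ^ b1 = b2 by apply/conjg_fixP/eqP/cB.
  transitivity [~ a3, b2].
    rewrite conjgM conjRg aa1 def_ba1 commgMJ (cA _ a2) // conj1g mulg1.
    by rewrite conjRg b2b1 def_ab1 commMgJ (cB b3) // conj1g mul1g.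
  rewrite conjgM conjRg bb1 def_ab1 commMgJ (cB b3) // conj1g mul1g.
  by rewrite conjRg a3a1 def_ba1 commgMJ (cA _ a2) // conj1g mulg1.
apply/centsP=> _ /imset2P[a b Aa Bb ->] _ /imset2P[a1 b1 Aa1 Bb1 ->].
apply/commgP/conjg_fixP.
(* Inverses are used because [[~ a1, b1]] is the quotient of [a1^-1 * b1^-1] by [b1^-1 * a1^-1], and
   these two act alike on [[~ a, b]]. *)
have := conjC a b a1^-1 b1^-1 Aa Bb; rewrite !groupV => /(_ Aa1 Bb1) eqJ.
have -> : [~ a1, b1] = a1^-1 * b1^-1 * (b1^-1 * a1^-1)^-1.
  by rewrite invMg !invgK /commg /conjg !mulgA.
by rewrite conjgM eqJ conjgK.
Qed.

(* If z = a * b is central, then a centralizes B because z and b do, so a is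
   central too. *)
Lemma center_sub_abelian_factor X A B :
    A * B = X -> abelian A -> abelian B -> 'Z(X) :&: A = 1 ->
  'Z(X) \subset B.
Proof.
move=> defX cAA cBB tiZA; apply/subsetP=> z Zz.
have: z \in A * B by rewrite defX (subsetP (center_sub X)).
case/mulsgP=> a b Aa Bb def_z.
suffices: a \in 'Z(X) :&: A by rewrite tiZA def_z => /set1gP->; rewrite mul1g.
have sAX : A \subset X by rewrite -defX mulG_subl.
rewrite !inE Aa (subsetP sAX) // andbT /= -defX centM inE (subsetP cAA) //=.
have cBz : z \in 'C(B).
  by have /setIP[_] := Zz; apply/subsetP/centS; rewrite -defX mulG_subr.
by rewrite -(mulgK b a) -def_z groupM // groupV (subsetP cBB).
Qed.

(** A central subgroup is normal, so the preimage of the intersection is a normal subgroup of [X]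
    inside [A]; by maximality it lies in the core. *)
Lemma center_quotient_gcore X A : A \subset X ->
  'Z(X / gcore A X) :&: (A / gcore A X) = 1.
Proof.
move=> sAX; set N := gcore_group A X; have nsNX : N <| X := gcore_normal sAX.
set K := _ :&: _.
have nsKX : K <| X / N.
  by apply: sub_center_normal; rewrite subsetIl.
have sNA : N \subset A := gcore_sub A X.
have nsNA : N <| A := normalS sNA sAX nsNX.
suffices sKN : coset N @*^-1 K \subset N.
  have: coset N @*^-1 K / N \subset N / N by apply: quotientS.
  by rewrite cosetpreK trivg_quotient => /trivgP.
apply: gcore_max; last first.
  by rewrite normal_norm // -(quotientGK nsNX) cosetpre_normal.
by rewrite -(quotientGK nsNA) cosetpreSK subsetIr.
Qed.

End AbelianFactorizations.

Section SkewProducts.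

Variable gT : finGroupType.
Local Notation L := (left_regular gT).

Lemma left_mulM (g h : gT) : left_mul (g * h) = left_mul h * left_mul g.
Proof. by apply/permP=> x; rewrite permM !left_mulE mulgA. Qed.

Lemma mem_left_mul (g : gT) : left_mul g \in L.
Proof. exact: imset_f. Qed.

Lemma abelian_left_regular : abelian [set: gT] -> abelian L.
Proof.
move=> cGG; apply/centsP=> _ /imsetP[g _ ->] _ /imsetP[h _ ->].
by rewrite /commute -!left_mulM (centsP cGG) ?inE.
Qed.

Lemma card_left_regular : #|L| = #|gT|.
Proof.
rewrite card_imset ?cardsT // => g h /permP/(_ 1).
by rewrite !left_mulE !mulg1.
Qed.

(* For abelian G, the left and right regular representations coincide, so an
   element s of the centralizer satisfies s h = h * s 1 = s 1 * h. *)
Lemma cent_left_regular : abelian [set: gT] -> 'C(L) \subset L.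
Proof.
move=> cGG; apply/subsetP=> s /centP cLs.
apply/imsetP; exists (s 1) => //; apply/permP=> h.
have /permP/(_ 1) := cLs _ (mem_left_mul h).
by rewrite !permM !left_mulE mulg1 => <-; rewrite (centsP cGG) ?inE.
Qed.

Lemma norm_left_regular_Aut (s : {perm gT}) :
  s 1 = 1 -> s \in 'N(L) -> s \in Aut [set: gT].
Proof.
move=> s1 nLs; rewrite inE; apply/andP; split.
  by apply/subsetP=> x _; rewrite inE.
apply/morphicP=> g h _ _.
have: left_mul g ^ s \in L by rewrite memJ_norm ?mem_left_mul.
(* The conjugate is [left_mul k] with [s (g * h) = k * s h]; taking [h = 1] identifies [k] as
   [s g]. *)
case/imsetP=> k _ /(congr1 (mulg s)); rewrite -conjgC => /permP eq_sk.
have := eq_sk 1; rewrite !permM !left_mulE s1 !mulg1 => ->.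
by have := eq_sk h; rewrite !permM !left_mulE.
Qed.

End SkewProducts.

Theorem theorem2 (p : nat) (p_prime : prime p) (gT : finGroupType)
    (abelian_G : abelian [set: gT]) (pgroup_G : p.-group [set: gT])
    (sigma : {perm gT}) (skew_sigma : skew_morphism sigma)
    (m : nat) (m_ge1 : 1 <= m) (order_sigma : #[sigma] = (p ^ m)%N) :
  let G : {group {perm gT}} := left_regular_group gT in
  let X : {group {perm gT}} := skew_product skew_sigma in
  let N : {group {perm gT}} := gcore_group G X in
  [/\ (* (1) *)
      'Z(X) \subset N /\ (X :!=: 1 -> N :!=: 1),
      (* (2) *)
      nil_class X <= 2 -> G <| X /\ sigma \in Aut [set: gT]
    & (* (3) *)
      ~~ (G <| X) ->
      [/\ p.-group (X / N), ~~ abelian (X / N), abelian (X / N)^`(1)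
        & [/\ 'Z(X / N) :!=: 1, cyclic 'Z(X / N)
            & 'Z(X / N) \subset <[sigma]> / N]] ].
Proof.
move=> G X N.
have defX' : <[sigma]> * G = X by [].
have defX : G * <[sigma]> = X by rewrite -(invGid X) -defX' invMg !invGid.
have sGX : G \subset X by rewrite -defX mulG_subl.
have sSX : <[sigma]> \subset X by rewrite -defX mulG_subr.
have cGG : abelian G by apply: abelian_left_regular.
have nsNX : N <| X := gcore_normal sGX.
have sNG : N \subset G := gcore_sub G X.
have pX : p.-group X.
  rewrite -defX' pgroupM /pgroup -orderE order_sigma pnatX pnat_id //=.
  by rewrite card_left_regular -cardsT.
have sZG : 'Z(X) \subset G.
  apply: subset_trans (cent_left_regular abelian_G).
  exact: subset_trans (subsetIr X 'C(X)) (centS sGX).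
have sZN : 'Z(X) \subset N.
  exact: gcore_max sZG (normal_norm (center_normal X)).
split.
(* A nilpotent group with trivial center is trivial, and [N = 1] would force ['Z(X) = 1]. *)
- split=> // ntX; apply: contraNneq ntX => N1.
  by rewrite -(center_nil_eq1 (pgroup_nil pX)) -subG1 -N1.
- rewrite nil_class2 => sX'Z.
  have nsGX : G <| X.
    by rewrite /normal sGX sub_der1_norm // (subset_trans sX'Z).
  split=> //; apply: norm_left_regular_Aut; first exact: proj1 skew_sigma.
  by rewrite (subsetP (normal_norm nsGX)) // (subsetP sSX) ?cycle_id.
move=> not_nsGX.
have nNG : G \subset 'N(N) := subset_trans sGX (normal_norm nsNX).
have defXN : (G / N) * (<[sigma]> / N) = X / N by rewrite -quotientMl ?defX.
have cGN : abelian (G / N) := quotient_abelian N cGG.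
have cycSN : cyclic (<[sigma]> / N) := quotient_cyclic N (cycle_cyclic sigma).
have cSN := cyclic_abelian cycSN.
(* Otherwise [G / N] would be normal in [X / N], and since [N] lies in [G], taking preimages would
   make [G] normal in [X]. *)
have ncXN : ~~ abelian (X / N).
  apply: contra not_nsGX => cXN.
  rewrite -(quotientGK (normalS sNG sGX nsNX)) -(quotientGK nsNX).
  by rewrite cosetpre_normal -sub_abelian_normal ?quotientS.
have pXN : p.-group (X / N) := quotient_pgroup N pX.
have sZS : 'Z(X / N) \subset <[sigma]> / N.
  exact: center_sub_abelian_factor defXN cGN cSN (center_quotient_gcore sGX).
split=> //; first exact: abelian_der1_mul_abelian defXN cGN cSN.
split=> //; last exact: cyclicS cycSN.
(* By nilpotency a trivial center would make [X / N] trivial, hence abelian. *)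
rewrite center_nil_eq1 ?(pgroup_nil pXN) //.
by apply: contraNneq ncXN => ->; apply: abelian1.
Qed.
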